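(* Let $L$ be a lattice of subgroups of an abelian group $A$, with meet $\cap$ and join $+$. The following conditions are equivalent: 1) $L$ is distributive. 2) For every finite family $I_{0},\ldots,I_{n}$ ($n\geq 0$) of members of $L$, the canonical morphism of complexes $$I_{0}\cap\cdots\cap I_{n}\longrightarrow {\rm C}^{\bullet}(I_{0},\ldots,I_{n})$$ is a quasi-isomorphism. Here $I_0\cap\cdots\cap I_n$ is regarded as a complex concentrated in degree $0$, the morphism sends $i$ to the constant $0$-cochain $(i,\ldots,i)$, and the complex ${\rm C}^{\bullet}(I_0,\ldots,I_n)$ is defined in the context.
   Context: A lattice $L$ of subgroups of an abelian group $A$ is a set of subgroups of $A$ closed under intersection $\cap$ (meet) and sum $+$ (join). It is distributive if $I_0+(I_1\cap I_2)=(I_0+I_1)\cap(I_0+I_2)$ for all $I_0,I_1,I_2\in L$ (equivalently, $I_0\cap(I_1+I_2)=(I_0\cap I_1)+(I_0\cap I_2)$ for all $I_0,I_1,I_2\in L$). For $I_0,\ldots,I_n\in L$ and $q\geq 0$, the group of $q$-cochains ${\rm C}^{q}(I_0,\ldots,I_n)$ is the subgroup of $$\prod_{0\leq\alpha_0,\ldots,\alpha_q\leq n}(I_{\alpha_0}+\cdots+I_{\alpha_q})$$ consisting of the families $(i_{\alpha_0\ldots\alpha_q})$ that are completely alternating in the indices, i.e. $i_{\alpha_0\ldots\alpha_q}$ changes sign when two indices are interchanged and is $0$ when two indices are equal. (Thus ${\rm C}^q$ can be identified with $\prod_{0\leq\alpha_0<\cdots<\alpha_q\leq n}(I_{\alpha_0}+\cdots+I_{\alpha_q})$.)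 The coboundary operator $d:{\rm C}^{q}(I_0,\ldots,I_n)\to{\rm C}^{q+1}(I_0,\ldots,I_n)$ is $$(di)_{\alpha_0\ldots\alpha_{q+1}}=\sum_{p=0}^{q+1}(-1)^p\, i_{\alpha_0\ldots\widehat{\alpha_p}\ldots\alpha_{q+1}},$$ where the hat denotes omission; one has $d\circ d=0$. *)

(* Defs.v *)
From HB Require Import structures.
From mathcomp Require Import all_boot all_order perm all_algebra.
From mathcomp Require Import zify.
From mathcomp Require Import boolp classical_sets.

Set Implicit Arguments.
Unset Strict Implicit.
Unset Printing Implicit Defensive.

Import GRing.Theory.
Local Open Scope ring_scope.
Local Open Scope quotient_scope.

(* A subgroup of A is an element of zmodClosed A. Such an element is a boolean
   predicate, so that, in the presence of boolp, all subgroups are covered. *)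
Section Subgroups.
Variable A : zmodType.
Implicit Types I J : zmodClosed A.

Lemma zmodClosed_ext I J : (I : {pred A}) =i J -> I = J.
Proof.
case: I J => [I [[IN] [ID]]] [J [[JN] [JD]]] /= eqIJ.
have {eqIJ}eqIJ : I = J by apply/funext.
case: J / eqIJ JN JD => JN JD.
by rewrite (Prop_irrelevance IN JN) (Prop_irrelevance ID JD).
Qed.

Definition zero_pred : {pred A} := [pred x | x == 0].
Lemma zero_pred_closed : zmod_closed zero_pred.
Proof.
split; first exact: eqxx.
by move=> x y /eqP-> /eqP->; rewrite subr0; apply: eqxx.
Qed.
HB.instance Definition _ := GRing.isZmodClosed.Build A zero_pred zero_pred_closed.
Definition zero_sub : zmodClosed A := zero_pred.

Definition full_pred : {pred A} := [pred x | true].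
Lemma full_pred_closed : zmod_closed full_pred. Proof. by []. Qed.
HB.instance Definition _ := GRing.isZmodClosed.Build A full_pred full_pred_closed.
Definition full_sub : zmodClosed A := full_pred.

Definition cap_pred I J : {pred A} := [pred x | (x \in I) && (x \in J)].
Lemma cap_pred_closed I J : zmod_closed (cap_pred I J).
Proof.
split; first by rewrite inE !rpred0.
by move=> x y /andP[xI xJ] /andP[yI yJ]; rewrite inE !rpredB.
Qed.
HB.instance Definition _ I J :=
  GRing.isZmodClosed.Build A (cap_pred I J) (cap_pred_closed I J).
Definition cap_sub I J : zmodClosed A := cap_pred I J.

Definition sum_pred I J : {pred A} :=
  [pred x | `[< exists y z, [/\ y \in I, z \in J & x = y + z] >]].
Lemma sum_pred_closed I J : zmod_closed (sum_pred I J).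
Proof.
split; first by apply/asboolP; exists 0, 0; rewrite !rpred0 addr0.
move=> _ _ /asboolP[y [z [yI zJ ->]]] /asboolP[y' [z' [yI' zJ' ->]]].
by apply/asboolP; exists (y - y'), (z - z'); rewrite !rpredB // opprD addrACA.
Qed.
HB.instance Definition _ I J :=
  GRing.isZmodClosed.Build A (sum_pred I J) (sum_pred_closed I J).
Definition sum_sub I J : zmodClosed A := sum_pred I J.

Lemma sum_subP I J x :
  reflect (exists y z, [/\ y \in I, z \in J & x = y + z]) (x \in sum_sub I J).
Proof. exact: asboolP. Qed.

Definition bigcap_sub n (I : 'I_n -> zmodClosed A) : zmodClosed A :=
  \big[cap_sub/full_sub]_(k < n) I k.

Definition bigsum_sub n (I : 'I_n -> zmodClosed A) : zmodClosed A :=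
  \big[sum_sub/zero_sub]_(k < n) I k.

Lemma bigcap_subP n (I : 'I_n -> zmodClosed A) x :
  reflect (forall k, x \in I k) (x \in bigcap_sub I).
Proof.
rewrite /bigcap_sub; elim: n I => [|n IHn] I.
  by rewrite big_ord0; apply: (iffP idP) => // _ [].
rewrite big_ord_recl; apply: (iffP andP) => [[x0 /IHn xI] k|xI].
  by case: (unliftP ord0 k) => [j|] ->.
by split; [apply: xI | apply/IHn => k; apply: xI].
Qed.

Lemma bigsum_subP n (I : 'I_n -> zmodClosed A) x :
  reflect (exists y : 'I_n -> A, (forall k, y k \in I k) /\ x = \sum_k y k)
          (x \in bigsum_sub I).
Proof.
rewrite /bigsum_sub; elim: n I x => [|n IHn] I x.
  rewrite big_ord0; apply: (iffP eqP) => [->|[y [_ ->]]]; last by rewrite big_ord0.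
  by exists (fun=> 0); rewrite big_ord0; split=> // -[].
rewrite big_ord_recl; apply: (iffP (sum_subP _ _ _)).
  case=> x0 [_ [x0I /IHn[y [yI ->]] ->]].
  exists (fun k => if unlift ord0 k is Some j then y j else x0); split=> [k|].
    by case: unliftP => [j|] ->.
  rewrite big_ord_recl unlift_none; congr (_ + _).
  by apply: eq_bigr => j _; rewrite liftK.
case=> y [yI ->]; exists (y ord0), (\sum_k y (lift ord0 k)).
rewrite big_ord_recl; split=> //; apply/IHn.
by exists (fun k => y (lift ord0 k)).
Qed.

Definition lattice_of_subgroups (L : set (zmodClosed A)) : Prop :=
  (forall I J, L I -> L J -> L (cap_sub I J)) /\
  (forall I J, L I -> L J -> L (sum_sub I J)).

Definition distributive (L : set (zmodClosed A)) : Prop :=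
  forall I0 I1 I2, L I0 -> L I1 -> L I2 ->
    sum_sub I0 (cap_sub I1 I2) = cap_sub (sum_sub I0 I1) (sum_sub I0 I2).

Definition group_of I : Type := {x : A | x \in I}.
HB.instance Definition _ I := SubChoice.on (group_of I).
HB.instance Definition _ I := [SubChoice_isSubZmodule of group_of I by <:].

End Subgroups.

(* A complex is graded by nat, and understood to be zero in negative degrees. *)
Record complex := Complex {
  obj :> nat -> zmodType;
  diff : forall q, {additive obj q -> obj q.+1};
  diff_diff : forall q x, diff q.+1 (diff q x) = 0
}.
Arguments diff C q : rename.

Record complex_morphism (C D : complex) := ComplexMorphism {
  mor :> forall q, {additive C q -> D q};
  mor_diff : forall q x, mor q.+1 (diff C q x) = diff D q (mor q x)
}.

Section Cohomology.

Section Degree.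
Variables (C : complex) (q : nat).

Definition cocycle_pred : {pred C q} := [pred x : C q | diff C q x == 0].
Lemma cocycle_pred_closed : zmod_closed cocycle_pred.
Proof.
split; first by rewrite inE raddf0.
by move=> x y /eqP dx /eqP dy; rewrite inE raddfB /= dx dy subr0.
Qed.
HB.instance Definition _ :=
  GRing.isZmodClosed.Build (C q) cocycle_pred cocycle_pred_closed.
Definition cocycles : zmodType := group_of cocycle_pred.

End Degree.

Arguments cocycle_pred : clear implicits.

Definition is_coboundary (C : complex) (q : nat) : C q -> Prop :=
  match q return C q -> Prop with
  | 0 => fun x => x = 0
  | q'.+1 => fun x => exists y : C q', x = diff C q' y
  end.

Section Degree.
Variables (C : complex) (q : nat).

Definition coboundary_pred : {pred cocycles C q} :=
  [pred z | `[< is_coboundary (val z) >]].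
Lemma coboundary_pred_closed : zmod_closed coboundary_pred.
Proof.
have cob0 : is_coboundary (0 : C q).
  by case: (q) => [//|q' /=]; exists 0; rewrite raddf0.
have cobB (x y : C q) : is_coboundary x -> is_coboundary y -> is_coboundary (x - y).
  case: (q) x y => [|q'] x y /=; first by move=> -> ->; rewrite subr0.
  by case=> x' -> [y' ->]; exists (x' - y'); rewrite raddfB.
split; first by apply/asboolP; rewrite raddf0.
by move=> x y /asboolP bx /asboolP by_; apply/asboolP; rewrite raddfB; apply: cobB.
Qed.
HB.instance Definition _ :=
  GRing.isZmodClosed.Build (cocycles C q) coboundary_pred coboundary_pred_closed.

Definition cohomology : zmodType := Quotient.quot coboundary_pred.

Definition coh_class (z : cocycles C q) : cohomology := \pi_cohomology z.

Lemma coh_classP (x y : cocycles C q) :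
  coh_class x = coh_class y <-> is_coboundary (val x - val y).
Proof.
split=> [/eqP|bxy]; first by rewrite -Quotient.idealrBE => /asboolP; rewrite raddfB.
by apply/eqP; rewrite -Quotient.idealrBE; apply/asboolP; rewrite raddfB.
Qed.

End Degree.

Section Functoriality.
Variables (C D : complex) (f : complex_morphism C D) (q : nat).

Lemma mor_cocycle (z : cocycles C q) : f q (val z) \in cocycle_pred D q.
Proof. by case: z => z /= /eqP dz; rewrite inE -mor_diff dz raddf0. Qed.

Definition cocycle_map (z : cocycles C q) : cocycles D q :=
  Sub (f q (val z)) (mor_cocycle z).

(* The choice of the representative is irrelevant: see cohomology_map_class. *)
Definition cohomology_map (h : cohomology C q) : cohomology D q :=
  coh_class (cocycle_map (repr h)).

Lemma mor_coboundary (x : C q) : is_coboundary x -> is_coboundary (f q x).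
Proof.
case: (q) x => [|q'] x /=; first by move->; rewrite raddf0.
by case=> y ->; exists (f q' y); rewrite mor_diff.
Qed.

Lemma cohomology_map_class (z : cocycles C q) :
  cohomology_map (coh_class z) = coh_class (cocycle_map z).
Proof.
apply/coh_classP; rewrite /= -raddfB; apply: mor_coboundary.
by apply/coh_classP; rewrite /coh_class reprK.
Qed.

Lemma cohomology_map_is_zmod_morphism : zmod_morphism cohomology_map.
Proof.
move=> x y; rewrite -[x]reprK -[y]reprK -!/(coh_class _).
have clB D' (a b : cocycles D' q) : coh_class a - coh_class b = coh_class (a - b).
  by rewrite /coh_class raddfB.
rewrite clB !cohomology_map_class clB; congr coh_class.
by apply: val_inj; rewrite /= !raddfB.
Qed.
HB.instance Definition _ := GRing.isZmodMorphism.Build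
  (cohomology C q) (cohomology D q) cohomology_map cohomology_map_is_zmod_morphism.

End Functoriality.

Arguments cohomology_map [C D] f q h.

(* The maps in cohomology being additive, the bijective ones are isomorphisms. *)
Definition quasi_isomorphism (C D : complex) (f : complex_morphism C D) : Prop :=
  forall q, bijective (cohomology_map f q).

End Cohomology.

Section Concentrated.
Variable M : zmodType.

Definition concentrated_obj (q : nat) : zmodType :=
  if q is 0 then M else group_of (zero_sub M).

Definition concentrated_diff q :
  {additive concentrated_obj q -> concentrated_obj q.+1} := \0.

Definition concentrated : complex :=
  @Complex concentrated_obj concentrated_diff (fun _ _ => erefl).

End Concentrated.

Section Cochains.
Variables (A : zmodType) (n : nat) (I : 'I_n.+1 -> zmodClosed A).

(* Multi-indices (alpha_0, ..., alpha_(q-1)). Since q-cochains are indexed by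
   q + 1 indices, they are families over multi_index q.+1. *)
Definition multi_index q : finType := {ffun 'I_q -> 'I_n.+1}.

Definition family_of q : zmodType := {ffun multi_index q.+1 -> A}.

Definition omit q (p : 'I_q.+1) (a : multi_index q.+1) : multi_index q :=
  [ffun k => a (lift p k)].

Definition interchange q (k l : 'I_q) (a : multi_index q) : multi_index q :=
  [ffun j => a (tperm k l j)].

Definition cochain_pred q : {pred family_of q} :=
  [pred i : family_of q |
    [&& [forall a, i a \in bigsum_sub (fun k => I (a k))],
        [forall a, forall k, forall l,
          (k != l) ==> (i (interchange k l a) == - i a)] &
        [forall a : multi_index q.+1, forall k, forall l,
          (k != l) && (a k == a l) ==> (i a == 0)]]].
Arguments cochain_pred : clear implicits.

Lemma cochainP q (i : family_of q) :
  reflect [/\ forall a, i a \in bigsum_sub (fun k => I (a k)),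
              forall a k l, k != l -> i (interchange k l a) = - i a &
              forall (a : multi_index q.+1) k l, k != l -> a k = a l -> i a = 0]
          (i \in cochain_pred q).
Proof.
apply: (iffP and3P) => [[/forallP iS /forallP iN /forallP i0] | [iS iN i0]]; split.
- by [].
- move=> a k l kl; have /forallP/(_ k)/forallP/(_ l) := iN a.
  by rewrite kl => /eqP.
- move=> a k l kl akl; have /forallP/(_ k)/forallP/(_ l) := i0 a.
  by rewrite kl akl eqxx => /eqP.
- exact/forallP.
- apply/forallP=> a; apply/forallP=> k; apply/forallP=> l.
  by apply/implyP=> kl; apply/eqP; apply: iN.
- apply/forallP=> a; apply/forallP=> k; apply/forallP=> l.
  by apply/implyP=> /andP[kl /eqP akl]; apply/eqP; apply: i0 akl.
Qed.

Lemma cochain_pred_closed q : zmod_closed (cochain_pred q).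
Proof.
split.
  apply/cochainP; split=> [a|a k l _|a k l _ _]; rewrite !ffunE ?rpred0 //.
  by rewrite oppr0.
move=> i j /cochainP[iS iN i0] /cochainP[jS jN j0]; apply/cochainP.
split=> [a|a k l kl|a k l kl akl]; rewrite !ffunE.
- exact: rpredB.
- by rewrite iN // jN // opprD.
- by rewrite (i0 a k l) // (j0 a k l) // subr0.
Qed.
HB.instance Definition _ q := GRing.isZmodClosed.Build
  (family_of q) (cochain_pred q) (cochain_pred_closed q).

Definition cochain q : zmodType := group_of (cochain_pred q).


(* The sign is an integer, acting on the abelian group A by *~. *)
Definition coboundary_family q (i : family_of q) : family_of q.+1 :=
  [ffun a : multi_index q.+2 => \sum_(p < q.+2) i (omit p a) *~ (-1) ^+ p].

Lemma cochain_perm q (i : family_of q) (s : 'S_q.+1) (a : multi_index q.+1) :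
  i \in cochain_pred q -> i [ffun k => a (s k)] = i a *~ (-1) ^+ s.
Proof.
case/cochainP=> _ iN _; case: (prod_tpermP s) => ts ->{s}.
elim: ts => [_|t ts IHts /= /andP[tD tsD]].
  rewrite big_nil odd_perm1 mulr1z; congr (i _); apply/ffunP=> k.
  by rewrite ffunE perm1.
rewrite big_cons odd_mul_tperm tD signr_addb expr1 mulN1r mulrNz -(IHts tsD).
rewrite -(iN _ _ _ tD); congr (i _); apply/ffunP=> k.
by rewrite !ffunE permM.
Qed.

Lemma lift_permP q (s : 'S_q.+1) (p : 'I_q.+1) :
  exists t : 'S_q, lift_perm p (s p) t = s.
Proof.
have sN k : s p != s (lift p k) by rewrite (inj_eq perm_inj) neq_lift.
pose g k := odflt k (unlift (s p) (s (lift p k))).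
have gE k : lift (s p) (g k) = s (lift p k).
  by have [j sj uj] := unlift_some (sN k); rewrite /g uj sj.
have g_inj : injective g.
  move=> k l /(congr1 (lift (s p))); rewrite !gE => /perm_inj.
  exact: lift_inj.
exists (perm g_inj); apply/permP=> k; case: (unliftP p k) => [j|] ->.
  by rewrite lift_perm_lift permE gE.
by rewrite lift_perm_id.
Qed.

Lemma omit_perm q (i : family_of q) (s : 'S_q.+2) p (a : multi_index q.+2) :
  i \in cochain_pred q ->
  i (omit p [ffun k => a (s k)]) *~ (-1) ^+ p =
  i (omit (s p) a) *~ (-1) ^+ (s p) *~ (-1) ^+ s.
Proof.
move=> iC; have [t ts] := lift_permP s p.
have -> : omit p [ffun k => a (s k)] = [ffun k => omit (s p) a (t k)].
  by apply/ffunP=> k; rewrite !ffunE -{1}ts lift_perm_lift.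
rewrite cochain_perm // -!mulrzA; congr (_ *~ _).
have -> : odd_perm s = odd p (+) odd (s p) (+) t by rewrite -{1}ts odd_lift_perm.
rewrite -(signr_odd _ p) -(signr_odd _ (s p)) -!signr_addb.
by case: (odd p) (odd (s p)) (odd_perm t) => [] [] [].
Qed.

Lemma coboundary_cochain q (i : family_of q) :
  i \in cochain_pred q -> coboundary_family i \in cochain_pred q.+1.
Proof.
move=> iC; have /cochainP[iS iN i0] := iC; apply/cochainP; split.
- move=> a; rewrite ffunE; apply: rpred_sum => p _; apply: rpredMz.
  have /bigsum_subP[y [yI ->]] := iS (omit p a).
  apply: rpred_sum => k _; apply/bigsum_subP.
  exists (fun l => if l == lift p k then y k else 0); split=> [l|].
    by case: eqP => [->|_]; rewrite ?rpred0 //; have := yI k; rewrite ffunE.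
  by rewrite (bigD1 (lift p k)) //= eqxx big1 ?addr0 // => l /negPf->.
- move=> a k l kl; rewrite !ffunE.
  under eq_bigr => p _ do rewrite /interchange omit_perm // odd_tperm kl mulrN1z.
  by rewrite sumrN; congr (- _); rewrite [RHS](reindex_perm (tperm k l)).
- move=> a k l kl akl; rewrite ffunE (bigD1 k) //= (bigD1 l) 1?eq_sym //=.
  rewrite big1 ?addr0 => [|p /andP[pk pl]].
    have aE : a = [ffun j => a (tperm k l j)].
      by apply/ffunP=> j; rewrite ffunE; case: tpermP => [->|->|].
    rewrite {1}aE omit_perm // odd_tperm kl tpermL mulrN1z addNr //.
  have [k' kE _] := unlift_some pk; have [l' lE _] := unlift_some pl.
  rewrite (i0 (omit p a) k' l') ?mul0rz //; last by rewrite !ffunE -kE -lE.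
  by apply: contraNneq kl => kl'; rewrite kE lE kl'.
Qed.

Lemma omit_omit q (a : multi_index q.+2) (p p' : 'I_q.+2) (r r' : 'I_q.+1) :
  (r < p)%N -> r' = p.-1 :> nat -> p' = r :> nat ->
  omit r (omit p a) = omit r' (omit p' a).
Proof.
move=> rp r'E p'E; apply/ffunP=> k; rewrite !ffunE; congr (a _); apply: val_inj.
rewrite /= /bump r'E p'E.
lia.
Qed.

Lemma coboundary_coboundary q (i : family_of q) :
  coboundary_family (coboundary_family i) = 0.
Proof.
apply/ffunP=> a; rewrite !ffunE.
under eq_bigr => p _ do rewrite ffunE mulrz_suml.
rewrite pair_big /= (bigID (fun u : 'I_q.+3 * 'I_q.+2 => u.2 < u.1)%N) /=.
pose h (u : 'I_q.+3 * 'I_q.+2) : 'I_q.+3 * 'I_q.+2 := (inord u.2, inord u.1.-1).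
pose h' (u : 'I_q.+3 * 'I_q.+2) : 'I_q.+3 * 'I_q.+2 := (inord u.2.+1, inord u.1).
apply/eqP; rewrite addr_eq0 -sumrN; apply/eqP.
rewrite [RHS](reindex_onto h h') /=; last first.
  move=> [p r] /=; rewrite -leqNgt => pr; congr (_, _); apply: val_inj.
    by rewrite /= !inordK //; move: (ltn_ord r) (ltn_ord p); lia.
  by rewrite /= !inordK //; move: (ltn_ord r) (ltn_ord p); lia.
apply: eq_big => [[p r] | [p r] /= rp] /=.
  have [pq rq] := (ltn_ord p, ltn_ord r).
  apply/idP/andP => [rp|[]].
    split; first by rewrite -leqNgt !inordK //; lia.
    by apply/eqP; congr (_, _); apply: val_inj; rewrite /= !inordK //; lia.
  rewrite -leqNgt => rp' /eqP[/(congr1 val) /= e1 /(congr1 val) /= e2].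
  move: rp' e1 e2; rewrite inordK; last lia.
  rewrite inordK; last lia.
  move=> rp'; rewrite inordK; last lia.
  by move=> e1 _; lia.
have [pq rq] := (ltn_ord p, ltn_ord r).
have rK : (inord r : 'I_q.+3) = r :> nat by rewrite inordK //; lia.
have pK : (inord p.-1 : 'I_q.+2) = p.-1 :> nat by rewrite inordK //; lia.
rewrite (omit_omit _ rp pK rK) rK pK.
rewrite -!mulrzA -mulrNz; congr (_ *~ _).
rewrite -!exprD; have -> : (r + p = (p.-1 + r).+1)%N by lia.
by rewrite exprS mulN1r.
Qed.

Definition cochain_diff_fun (q : nat) (i : cochain q) : cochain q.+1 :=
  Sub (coboundary_family (val i)) (coboundary_cochain (valP i)).

Lemma cochain_diff_is_zmod_morphism q : zmod_morphism (@cochain_diff_fun q).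
Proof.
move=> i j; apply: val_inj; apply/ffunP=> a; rewrite /= !ffunE -sumrB.
by apply: eq_bigr => p _; rewrite !ffunE mulrzBl.
Qed.
HB.instance Definition _ q := GRing.isZmodMorphism.Build
  (cochain q) (cochain q.+1) (@cochain_diff_fun q) (@cochain_diff_is_zmod_morphism q).

Definition cochain_diff q : {additive cochain q -> cochain q.+1} :=
  @cochain_diff_fun q.

Lemma cochain_diff_diff q (i : cochain q) : cochain_diff q.+1 (cochain_diff q i) = 0.
Proof. by apply: val_inj; apply: coboundary_coboundary. Qed.

Definition cochain_complex : complex := Complex cochain_diff_diff.

Definition bigcap_group : zmodType := group_of (bigcap_sub I).

Definition constant_family (x : A) : family_of 0 := [ffun _ => x].

Lemma constant_cochain (x : bigcap_group) :
  constant_family (val x) \in cochain_pred 0.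
Proof.
have /bigcap_subP xI := valP x; apply/cochainP; split=> [a|a k l|a k l].
- apply/bigsum_subP; exists (fun=> val x); rewrite big_ord1 ffunE.
  by split=> // k; apply: xI.
- by rewrite (ord1 k) (ord1 l) eqxx.
- by rewrite (ord1 k) (ord1 l) eqxx.
Qed.

Definition constant_fun (x : bigcap_group) : cochain 0 :=
  Sub (constant_family (val x)) (constant_cochain x).

Lemma constant_is_zmod_morphism : zmod_morphism constant_fun.
Proof. by move=> x y; apply: val_inj; apply/ffunP=> a; rewrite !ffunE. Qed.
HB.instance Definition _ := GRing.isZmodMorphism.Build
  bigcap_group (cochain 0) constant_fun constant_is_zmod_morphism.

Definition canonical_mor q :
  {additive concentrated bigcap_group q -> cochain_complex q} :=
  match q with
  | 0 => constant_fun
  | q'.+1 => \0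
  end.

Lemma canonical_mor_diff q (x : concentrated bigcap_group q) :
  canonical_mor q.+1 (diff (concentrated bigcap_group) q x) =
  diff cochain_complex q (canonical_mor q x).
Proof.
case: q x => [|q] x /=; last by rewrite raddf0.
apply: val_inj; apply/ffunP=> a; rewrite /= !ffunE.
rewrite !big_ord_recl big_ord0 !ffunE /=.
by rewrite expr0 expr1 mulrNz mulr1z addr0 subrr.
Qed.

Definition canonical_morphism :
  complex_morphism (concentrated bigcap_group) cochain_complex :=
  ComplexMorphism canonical_mor_diff.

End Cochains.

(* Main.v *)
Require Import Defs.
From mathcomp Require Import all_boot all_order perm all_algebra.
From mathcomp Require Import boolp classical_sets.

(** The morphism is always bijective in cohomology in degree 0, since a 0-cocycle
    is a constant family. So both implications are about the vanishing of the
    cohomology of the cochain complexes in positive degrees.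

    If it vanishes in degree 1 for three members, let x be in the intersection
    of I0 + I1 and I0 + I2. The family (x, x, 0) at the indices 01, 02, 12 is a
    1-cocycle, hence the coboundary of some (y0, y1, y2) with y k in I k. Then
    y1 = y2 is in the intersection of I1 and I2, and x = - y0 + y1
    ([quasi_isomorphism_distributive]).

    Conversely, let L be distributive. Fix the index set and let a list s of
    indices grow: the assertion [acyclic_on L s q] is about alternating families
    on all indices, with values in A, whose values and coboundary are only
    constrained on multi-indices with entries in s. To add an index b to s, let i
    be a (q+1)-cocycle. Its cone, which puts b in front of each multi-index, is a
    primitive of i ([coneK]), but has its values in the sums of the I k + I b
    instead of the I k. By induction there is also a primitive h of i inside s
    with the right values, and cone - h is inside s a q-cocycle for the family
    I k + I b. For q > 0, by induction again, this time for the family I k + I b,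
    it is inside s the coboundary of some k; subtracting from the cone the
    coboundary of k, extended by zero, leaves h inside s. For q = 0 the cocycle
    is a constant in the intersection of the I k + I b, which distributivity
    splits into a part in all the I k and a part in I b; subtracting the latter
    from the cone leaves the right values ([exists_correction],
    [acyclic_on_cons]). *)

Set Implicit Arguments.
Unset Strict Implicit.
Unset Printing Implicit Defensive.

Import GRing.Theory.
Local Open Scope ring_scope.

(** * Sums of subgroups and distributivity *)

Section Subgroups.
Variable A : zmodType.
Implicit Types (I J M : zmodClosed A) (L : set (zmodClosed A)).

Lemma mem_bigsum_sub n (I : 'I_n -> zmodClosed A) k x :
  x \in I k -> x \in bigsum_sub I.
Proof.
move=> xI; apply/bigsum_subP; exists (fun l => if l == k then x else 0).
split=> [l|]; first by case: eqP => [->|_]; rewrite ?rpred0.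
by rewrite (bigD1 k) //= eqxx big1 ?addr0 // => l /negPf->.
Qed.

Lemma bigsum_sub_min n (I : 'I_n -> zmodClosed A) J x :
  (forall k y, y \in I k -> y \in J) -> x \in bigsum_sub I -> x \in J.
Proof.
by move=> IJ /bigsum_subP[y [yI ->]]; apply: rpred_sum => k _; apply: IJ.
Qed.

Lemma mem_sum_subl I J x : x \in I -> x \in sum_sub I J.
Proof. by move=> xI; apply/sum_subP; exists x, 0; rewrite rpred0 addr0. Qed.

Lemma mem_sum_subr I J x : x \in J -> x \in sum_sub I J.
Proof. by move=> xJ; apply/sum_subP; exists 0, x; rewrite rpred0 add0r. Qed.

Lemma mem_sum_sub_min I J M x : (forall y, y \in I -> y \in M) ->
  (forall y, y \in J -> y \in M) -> x \in sum_sub I J -> x \in M.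
Proof.
move=> IM JM /sum_subP[y [z [yI zJ ->]]].
by apply: rpredD; [apply: IM | apply: JM].
Qed.

(** Distributivity extends to finite meets: intersecting the sums I k + J gives
    the sum of J and the intersection of the I k. The statement unfolds this into
    a decomposition of x, so that it also makes sense when s is empty, where the
    intersection of the I k would be the whole group, which need not be in L. *)
Lemma distributive_split L (T : eqType) (I : T -> zmodClosed A) J (s : seq T)
    x :
  lattice_of_subgroups L -> distributive L -> (forall k, L (I k)) -> L J ->
  (forall k, k \in s -> x \in sum_sub (I k) J) ->
  exists2 b, b \in J & forall k, k \in s -> x - b \in I k.
Proof.
move=> [LI _] dL LIk LJ xIJ.
case: s xIJ => [|k s] xIJ; first by exists 0; rewrite ?rpred0.
(* M is the intersection of the I l, a member of L because k :: s is not empty. *)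
suff [M [LM xM MI]] : exists M, [/\ L M, x \in sum_sub J M &
    forall l, l \in k :: s -> forall y, y \in M -> y \in I l].
  have /sum_subP[b [a [bJ aM ->]]] := xM.
  by exists b => // l ls; rewrite addrAC subrr add0r; apply: (MI l).
have sumC I0 : x \in sum_sub I0 J -> x \in sum_sub J I0.
  by apply: mem_sum_sub_min => y ?; [apply: mem_sum_subr | apply: mem_sum_subl].
elim: s k xIJ => [|l s IHs] k xIJ.
  exists (I k); split=> // [|l /[!inE]/eqP-> //].
  by apply: sumC; apply: xIJ; rewrite mem_head.
have [j js|M [LM xM MI]] := IHs l; first by apply: xIJ; rewrite inE js orbT.
exists (cap_sub (I k) M); split; first exact: LI.
  rewrite dL //; apply/andP; split=> //.
  by apply: sumC; apply: xIJ; rewrite mem_head.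
by move=> j /[1!inE]/predU1P[->|js] y /andP[yk yM]; last exact: (MI j).
Qed.

End Subgroups.

(** * Alternating families and cones *)

Section Families.
Variables (A : zmodType) (n : nat).
Implicit Types (I : 'I_n.+1 -> zmodClosed A) (b : 'I_n.+1) (s : seq 'I_n.+1).

(* Cochains for the constant family equal to A are only required to alternate. *)
Local Notation alternating q :=
  (cochain_pred (fun _ : 'I_n.+1 => full_sub A) (q := q)).

Lemma alternatingP q (i : family_of A n q) :
  reflect ((forall a k l, k != l -> i (Defs.interchange k l a) = - i a) /\
           (forall (a : multi_index n q.+1) k l,
              k != l -> a k = a l -> i a = 0))
          (i \in alternating q).
Proof.
apply: (iffP (cochainP _ _)) => [[]|[iN i0]] //; split=> // a.
exact: (mem_bigsum_sub (k := ord0)).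
Qed.

Lemma cochainE I q (i : family_of A n q) : i \in cochain_pred I (q := q) <->
  i \in alternating q /\ forall a, i a \in bigsum_sub (fun k => I (a k)).
Proof.
split=> [/cochainP[iI iN i0]|[/alternatingP[iN i0] iI]].
  by split=> //; apply/alternatingP.
by apply/cochainP.
Qed.

Lemma family_subE q (i j : family_of A n q) a : (i - j) a = i a - j a.
Proof. by rewrite !ffunE. Qed.

Lemma coboundary_familyB q (i j : family_of A n q) :
  coboundary_family (i - j) = coboundary_family i - coboundary_family j.
Proof.
apply/ffunP=> a; rewrite !ffunE -sumrB.
by apply: eq_bigr => p _; rewrite !ffunE mulrzBl.
Qed.

Lemma coboundary_family0E (f : family_of A n 0) (a : multi_index n 2) :
  coboundary_family f a =
    f [ffun=> a (lift ord0 ord0)] - f [ffun=> a ord0].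
Proof.
rewrite ffunE !big_ord_recl big_ord0 expr0 expr1 mulrNz mulr1z addr0.
congr (f _ - f _); apply/ffunP=> k; rewrite !ffunE (ord1 k) //.
by congr (a _); apply: val_inj.
Qed.

Definition cons_index q b (a : multi_index n q) : multi_index n q.+1 :=
  [ffun k => if unlift ord0 k is Some j then a j else b].

Definition cone b q (i : family_of A n q.+1) : family_of A n q :=
  [ffun a => i (cons_index b a)].

Lemma cons_index0 q b (a : multi_index n q) : cons_index b a ord0 = b.
Proof. by rewrite ffunE unlift_none. Qed.

Lemma cons_index_lift q b (a : multi_index n q) k :
  cons_index b a (lift ord0 k) = a k.
Proof. by rewrite ffunE liftK. Qed.

Lemma cone_alternating b q (i : family_of A n q.+1) :
  i \in alternating (q.+1) -> cone b i \in alternating q.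
Proof.
move=> /alternatingP[iN i0]; apply/alternatingP; split=> [a k l kl|].
  rewrite !ffunE -(iN _ (lift ord0 k) (lift ord0 l)) ?(inj_eq lift_inj) //.
  congr (i _); apply/ffunP=> j; rewrite [RHS]ffunE.
  case: (unliftP ord0 j) => [j'|] ->; last first.
    by rewrite tpermD ?cons_index0 // eq_sym neq_lift.
  rewrite cons_index_lift ffunE -(cons_index_lift b); congr (cons_index b a _).
  case: tpermP => [->|->|jk jl]; rewrite ?tpermL ?tpermR //.
  by rewrite tpermD // (inj_eq lift_inj) eq_sym; apply/eqP.
move=> a k l kl akl.
rewrite ffunE (i0 _ (lift ord0 k) (lift ord0 l)) ?(inj_eq lift_inj) //.
by rewrite !cons_index_lift.
Qed.

(** The cone with apex b is a contracting homotopy. It is not one of the cochain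
    complex of I, since it does not preserve the values: see [cone_in_family]. *)
Lemma coneK b q (i : family_of A n q.+1) (a : multi_index n q.+2) :
  coboundary_family (cone b i) a = i a - coboundary_family i (cons_index b a).
Proof.
rewrite !ffunE [X in _ - X]big_ord_recl expr0 mulr1z.
have -> : omit ord0 (cons_index b a) = a.
  by apply/ffunP=> k; rewrite ffunE cons_index_lift.
rewrite opprD addNKr -sumrN; apply: eq_bigr => p _.
rewrite ffunE lift0 exprS mulN1r mulrNz opprK; congr (i _ *~ _).
apply/ffunP=> k; rewrite [RHS]ffunE; case: (unliftP ord0 k) => [k'|] ->.
  rewrite cons_index_lift ffunE -(cons_index_lift b); congr (cons_index b a _).
  by apply: val_inj; rewrite /= /bump /= !add1n ltnS addnS.
rewrite cons_index0 -[LHS](cons_index0 b a); congr (cons_index b a _).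
by apply: val_inj.
Qed.

Lemma cone_mem0 b q (i : family_of A n q.+1) (a : multi_index n q.+1) k :
  i \in alternating (q.+1) -> a k = b -> cone b i a = 0.
Proof.
move=> /alternatingP[_ i0] ak; rewrite ffunE (i0 _ ord0 (lift ord0 k)) //.
by rewrite cons_index0 cons_index_lift.
Qed.

(** * Acyclicity inside a list of indices *)

Definition inside s q (a : multi_index n q) := [forall k, a k \in s].

Lemma insideP s q (a : multi_index n q) :
  reflect (forall k, a k \in s) (inside s a).
Proof. exact: forallP. Qed.

Lemma inside_omit s q (a : multi_index n q.+1) p :
  inside s a -> inside s (omit p a).
Proof. by move=> /insideP sa; apply/insideP=> k; rewrite ffunE. Qed.

Lemma inside_cons s q b (a : multi_index n q) :
  b \in s -> inside s a -> inside s (cons_index b a).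
Proof.
move=> sb /insideP sa; apply/insideP=> k; rewrite ffunE.
by case: unlift.
Qed.

Lemma inside_consW s q b (a : multi_index n q) :
  inside s a -> inside (b :: s) a.
Proof. by move=> /insideP sa; apply/insideP=> k; rewrite inE sa orbT. Qed.

Lemma inside_cons_inv s q b (a : multi_index n q) :
  inside (b :: s) a -> (exists k, a k = b) \/ inside s a.
Proof.
move=> /insideP sa.
have [/existsP[k /eqP]|/existsPn bN] := boolP [exists k, a k == b].
  by left; exists k.
right; apply/insideP=> k; have := sa k; rewrite inE.
by rewrite (negPf (bN k)).
Qed.

Definition restrict s q (i : family_of A n q) : family_of A n q :=
  [ffun a => if inside s a then i a else 0].

Lemma restrict_alternating s q (i : family_of A n q) :
  i \in alternating q -> restrict s i \in alternating q.
Proof.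
move=> /alternatingP[iN i0]; apply/alternatingP; split=> [a k l kl|].
  rewrite !ffunE iN //.
  suff -> : inside s (Defs.interchange k l a) = inside s a.
    by case: ifP; rewrite ?oppr0.
  apply/insideP/insideP=> sa j; last by rewrite ffunE.
  by have := sa (tperm k l j); rewrite ffunE tpermK.
move=> a k l kl akl.
by rewrite ffunE; case: ifP => // _; rewrite (i0 a k l).
Qed.

Lemma eq_coboundary_inside s q (i j : family_of A n q)
    (a : multi_index n q.+2) :
  (forall c, inside s c -> i c = j c) -> inside s a ->
  coboundary_family i a = coboundary_family j a.
Proof.
by move=> ij sa; rewrite !ffunE; apply: eq_bigr => p _; rewrite ij ?inside_omit.
Qed.

Definition in_family s I q (i : family_of A n q) :=
  forall a, inside s a -> i a \in bigsum_sub (fun k => I (a k)).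

Definition cocycle_on s q (i : family_of A n q) :=
  forall a, inside s a -> coboundary_family i a = 0.

(** Families alternate on all multi-indices, and not only inside s, so that cones
    and coboundaries of the families produced by the induction alternate. *)
Definition acyclic_on (L : set (zmodClosed A)) s q :=
  forall I, (forall k, L (I k)) -> forall i : family_of A n q.+1,
  i \in alternating (q.+1) -> in_family s I i -> cocycle_on s i ->
  exists h : family_of A n q, [/\ h \in alternating q, in_family s I h &
    forall a, inside s a -> coboundary_family h a = i a].

(** Members of L again, by closure under sums: induction on s applies to them. *)
Definition shift_by I b k := sum_sub (I k) (I b).

Lemma cone_in_family s I b q (i : family_of A n q.+1) :
  in_family (b :: s) I i -> in_family s (shift_by I b) (cone b i).
Proof.
move=> iI a sa; rewrite ffunE.
apply: bigsum_sub_min (iI _ _) => [k y|]; last first.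
  by rewrite inside_cons ?inside_consW ?mem_head.
case: (unliftP ord0 k) => [j|] ->; rewrite ?cons_index_lift ?cons_index0 => yI.
  by apply: (mem_bigsum_sub (k := j)); apply: mem_sum_subl.
by apply: (mem_bigsum_sub (k := ord0)); apply: mem_sum_subr.
Qed.

Lemma in_family_shift s I b q (i : family_of A n q) :
  in_family s I i -> in_family s (shift_by I b) i.
Proof.
move=> iI a sa; apply: bigsum_sub_min (iI a sa) => k y yI.
by apply: (mem_bigsum_sub (k := k)); apply: mem_sum_subl.
Qed.

(** The values of k lie in sums of some of the I (a j) and of I b, which is
    itself one of the I (a j), as a passes through b. *)
Lemma restrict_coboundary_in s I b q (k : family_of A n q)
    (a : multi_index n q.+2) l :
  in_family s (shift_by I b) k -> a l = b ->
  coboundary_family (restrict s k) a \in bigsum_sub (fun j => I (a j)).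
Proof.
move=> kI al; rewrite ffunE; apply: rpred_sum => p _; apply: rpredMz.
rewrite ffunE; case: ifP => [sa|_]; last exact: rpred0.
apply: bigsum_sub_min (kI _ sa) => j y; rewrite ffunE.
apply: mem_sum_sub_min => z zI; first exact: (mem_bigsum_sub (k := lift p j)).
by apply: (mem_bigsum_sub (k := l)); rewrite al.
Qed.

Lemma acyclic_on_nil L q : acyclic_on L [::] q.
Proof.
by move=> I _ i _ _ _; exists 0; split=> [|a|a]; rewrite ?rpred0 //;
  move=> /insideP /(_ ord0).
Qed.

Lemma bigsum_sub1 I (a : multi_index n 1) x :
  (x \in bigsum_sub (fun k => I (a k))) = (x \in I (a ord0)).
Proof.
apply/idP/idP; last exact: (mem_bigsum_sub (k := ord0)).
by apply: bigsum_sub_min => k y; rewrite (ord1 k).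
Qed.

(** What has to be subtracted from a cocycle g with values in the sums of the
    I k + I b, without changing its coboundary, to bring its values inside s
    into the sums of the I k. The third clause makes -e an acceptable family on
    the indices through b, where the cone to be repaired vanishes. *)
Definition correction s I b q (g e : family_of A n q) :=
  [/\ e \in alternating q, coboundary_family e = 0,
      forall (a : multi_index n q.+1) k, a k = b ->
        e a \in bigsum_sub (fun j => I (a j)) &
      in_family s I (g - e)].

(** A 0-cocycle is a constant c lying in every I k + I b. Distributivity writes
    it as a + x with a in the intersection of the I k and x in I b, and the
    constant family x is the correction. This is where distributivity enters. *)
Lemma exists_correction0 L b s I (g : family_of A n 0) :
  lattice_of_subgroups L -> distributive L -> (forall k, L (I k)) ->
  in_family s (shift_by I b) g -> cocycle_on s g ->
  exists e, correction s I b g e.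
Proof.
move=> hL dL LI gI dg.
have gc k l : k \in s -> l \in s -> g [ffun=> k] = g [ffun=> l].
  move=> ks ls; pose a : multi_index n 2 := cons_index l [ffun=> k].
  have sa : inside s a.
    by rewrite inside_cons //; apply/insideP=> j; rewrite ffunE.
  apply/eqP; rewrite -subr_eq0 -(dg a sa) coboundary_family0E.
  by rewrite cons_index_lift cons_index0 [fun_of_fin [ffun=> k] ord0]ffunE.
(* When s is empty there is no condition inside s, and 0 will do. *)
pose c := if s is k :: _ then g [ffun=> k] else 0.
have gE (a : multi_index n 1) : inside s a -> g a = c.
  move=> /insideP/(_ ord0) as0.
  have -> : a = [ffun=> a ord0] by apply/ffunP=> j; rewrite ffunE (ord1 j).
  rewrite /c; case: (s) as0 gc => // k s' as0 gc.
  by apply: gc; rewrite ?mem_head.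
have cI k : k \in s -> c \in sum_sub (I k) (I b).
  move=> ks.
  have sk : inside s [ffun _ : 'I_1 => k] by apply/insideP=> j; rewrite ffunE.
  by have := gI _ sk; rewrite (gE _ sk) bigsum_sub1 ffunE.
have [x xI cx] := distributive_split hL dL LI (LI b) cI.
exists (constant_family n x); split.
- by apply/alternatingP; split=> a k l; rewrite (ord1 k) (ord1 l) eqxx.
- by apply/ffunP=> a; rewrite coboundary_family0E !ffunE subrr.
- by move=> a k ak; rewrite ffunE (mem_bigsum_sub (k := k)) // ak.
- move=> a sa; rewrite family_subE gE // ffunE bigsum_sub1; apply: cx.
  by move/insideP: sa.
Qed.

(** In positive degree the family g is, inside s, the coboundary of some k with
    values in the sums of the I k + I b, and the correction is the coboundary
    of k extended by zero. Its values on indices through b are harmless: there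
    I b is one of the summands. *)
Lemma exists_correction L b s I q (g : family_of A n q) :
  lattice_of_subgroups L -> distributive L -> (forall k, L (I k)) ->
  (forall q', acyclic_on L s q') ->
  g \in alternating q -> in_family s (shift_by I b) g -> cocycle_on s g ->
  exists e, correction s I b g e.
Proof.
move=> hL dL LI IHs; case: q g => [|q] g gA gI dg.
  exact: (exists_correction0 hL dL).
have LI' k : L (shift_by I b k) by apply: hL.2.
have [k [kA kI dk]] := IHs q _ LI' _ gA gI dg.
exists (coboundary_family (restrict s k)); split.
- by rewrite coboundary_cochain ?restrict_alternating.
- exact: coboundary_coboundary.
- by move=> a l al; apply: restrict_coboundary_in al.
- move=> a sa; rewrite family_subE (eq_coboundary_inside (j := k) (s := s)) //.
    by rewrite dk // subrr rpred0.
  by move=> a' sa'; rewrite ffunE sa'.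
Qed.

(** The cone of i with apex b is a primitive of i, with values in the sums of
    the I k + I b, while the inductive hypothesis provides a primitive h inside
    s with the right values. A correction of their difference repairs the cone
    inside s; on an index through b the cone vanishes, and only the value of
    the correction remains. *)
Lemma acyclic_on_cons L b s :
  lattice_of_subgroups L -> distributive L ->
  (forall q, acyclic_on L s q) -> forall q, acyclic_on L (b :: s) q.
Proof.
move=> hL dL IHs q I LI i iA iI di.
have [h [hA hI dh]] : exists h : family_of A n q, [/\ h \in alternating q,
    in_family s I h & forall a, inside s a -> coboundary_family h a = i a].
  by apply: IHs => // a /(inside_consW b); [apply: iI | apply: di].
have dsi a : inside (b :: s) a -> coboundary_family (cone b i) a = i a.
  by move=> sa; rewrite coneK di ?subr0 ?inside_cons ?mem_head.
have [e [eA de eb es]] : exists e, correction s I b (cone b i - h) e.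
  apply: (exists_correction hL dL LI IHs).
  - by rewrite rpredB ?cone_alternating.
  - move=> a sa; rewrite family_subE rpredB //; last exact: in_family_shift sa.
    exact: cone_in_family iI _ sa.
  - move=> a sa; rewrite coboundary_familyB family_subE dh //.
    by rewrite dsi ?subrr ?inside_consW.
exists (cone b i - e); split.
- by rewrite rpredB ?cone_alternating.
- move=> a /inside_cons_inv[[k ak]|sa].
    by rewrite family_subE (cone_mem0 iA ak) sub0r rpredN (eb _ k).
  have -> : (cone b i - e) a = (cone b i - h - e) a + h a.
    by rewrite !family_subE addrAC subrK.
  by rewrite rpredD ?es ?hI.
- by move=> a sa; rewrite coboundary_familyB de subr0 dsi.
Qed.

Lemma distributive_acyclic L I q (i : family_of A n q.+1) :
  lattice_of_subgroups L -> distributive L -> (forall k, L (I k)) ->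
  i \in cochain_pred I (q := q.+1) -> coboundary_family i = 0 ->
  exists2 h, h \in cochain_pred I (q := q) & i = coboundary_family h.
Proof.
move=> hL dL LI /cochainE[iA iI] di.
have sT q' (a : multi_index n q') : inside (enum 'I_n.+1) a.
  by apply/insideP=> k; rewrite mem_enum.
have H s q' : acyclic_on L s q'.
  elim: s q' => [|b s IHs] q'; first exact: acyclic_on_nil.
  exact: acyclic_on_cons.
have [||h [hA hI dh]] := H (enum 'I_n.+1) q I LI i iA.
- by move=> a _; apply: iI.
- by move=> a _; rewrite di ffunE.
exists h; first by apply/cochainE; split=> // a; apply: hI.
by apply/ffunP=> a; rewrite dh.
Qed.

End Families.

(** * Quasi-isomorphisms and distributivity *)

Lemma cohomology_map_bijP (C D : complex) (f : complex_morphism C D) q :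
  bijective (cohomology_map f (q := q)) <->
  (forall z : cocycles C q,
     is_coboundary (f q (val z)) -> is_coboundary (val z)) /\
  (forall w : cocycles D q, exists z : cocycles C q,
     is_coboundary (val w - f q (val z))).
Proof.
have pi (E : complex) (x : cohomology E q) : exists z, x = coh_class z.
  by exists (repr x); rewrite /coh_class reprK.
have class0 (E : complex) (z : cocycles E q) :
    coh_class z = coh_class 0 <-> is_coboundary (val z).
  by rewrite coh_classP raddf0 addr0.
split=> [[g fK gK]|[inj surj]].
  split=> [z bz|w].
    apply/class0; apply: (can_inj fK).
    rewrite !cohomology_map_class; apply/coh_classP.
    by rewrite /= !raddf0 addr0.
  have [z gw] := pi _ (g (coh_class w)); exists z.
  have /coh_classP // : coh_class w = coh_class (cocycle_map f z).
  by rewrite -cohomology_map_class -gw gK.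
have injf : injective (cohomology_map f (q := q)).
  move=> x y; have [[z ->] [z' ->]] := (pi _ x, pi _ y).
  rewrite !cohomology_map_class => /coh_classP; rewrite /= -raddfB => bzz'.
  by apply/coh_classP; apply: (inj (z - z')).
have surjf (y : cohomology D q) : exists x, cohomology_map f x = y.
  have [w ->] := pi _ y; have [z bz] := surj w; exists (coh_class z).
  by rewrite cohomology_map_class; apply/esym/coh_classP.
have [g gK] := choice surjf.
by exists g => // x; apply: injf; rewrite gK.
Qed.

Section Equivalence.
Variables (A : zmodType) (L : set (zmodClosed A)).

Lemma distributive_quasi_isomorphism n (I : 'I_n.+1 -> zmodClosed A) :
  lattice_of_subgroups L -> distributive L -> (forall k, L (I k)) ->
  quasi_isomorphism (canonical_morphism I).
Proof.
move=> hL dL LI [|q]; apply/cohomology_map_bijP; split.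
- move=> z /= /(congr1 (fun i : cochain I 0 => val i [ffun=> ord0])) /=.
  by rewrite !ffunE => z0; apply: val_inj.
- move=> w; have /eqP/(congr1 val)/= dw := valP w; pose i := val (val w).
  have /cochainE[iA iI] := valP (val w).
  have ic (a : multi_index n 1) : i a = i [ffun=> ord0].
    apply/eqP; rewrite -subr_eq0.
    have := congr1 (fun f : family_of A n 1 => f (cons_index ord0 a)) dw.
    rewrite /= coboundary_family0E cons_index_lift cons_index0 ffunE => /eqP.
    congr (i _ - _ == _); apply/ffunP=> k; rewrite ffunE (ord1 k) //.
  have xI : i [ffun=> ord0] \in bigcap_sub I.
    apply/bigcap_subP=> k; have := iI [ffun=> k].
    by rewrite bigsum_sub1 ffunE -/i ic.
  pose x : concentrated (bigcap_group I) 0 :=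
    (Sub (i [ffun=> ord0]) xI : bigcap_group I).
  have xc : x \in @cocycle_pred (concentrated (bigcap_group I)) 0.
    by rewrite inE.
  exists (Sub x xc : cocycles (concentrated (bigcap_group I)) 0).
  by apply: val_inj; apply/ffunP=> a; rewrite /= !ffunE -/i ic subrr.
- move=> z _; exists 0; apply: val_inj.
  exact/eqP/(valP (val z)).
- move=> w; have /eqP/(congr1 val)/= dw := valP w.
  have [h hI wE] := distributive_acyclic hL dL LI (valP (val w)) dw.
  by exists 0, (Sub h hI : cochain I q); rewrite raddf0 addr0; apply: val_inj.
Qed.

Lemma quasi_isomorphism_distributive :
  (forall (n : nat) (I : 'I_n.+1 -> zmodClosed A),
     (forall k, L (I k)) -> quasi_isomorphism (canonical_morphism I)) ->
  distributive L.
Proof.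
move=> qI I0 I1 I2 L0 L1 L2; apply: zmodClosed_ext => x; apply/idP/idP.
  apply: mem_sum_sub_min => y yI.
    by apply/andP; split; apply: mem_sum_subl.
  by case/andP: yI => y1 y2; apply/andP; split; apply: mem_sum_subr.
move=> /andP[x1 x2].
pose I (k : 'I_3) := nth I0 [:: I0; I1; I2] k.
have LI k : L (I k) by case: k => [[|[|[]]]].
(* The coboundary of the A-valued g is (x, x, 0) at 01, 02, 12: the cocycle and
   alternation conditions come for free. *)
pose g : family_of A 2 0 := 
    [ffun a : multi_index 2 1 => if a ord0 == ord0 then 0 else x].
have xI k : k != ord0 -> x \in sum_sub (I ord0) (I k) by case: k => [[|[|[]]]].
have wI : coboundary_family g \in cochain_pred I (q := 1).
  apply/cochainE; split.
    apply: coboundary_cochain; apply/alternatingP.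
    by split=> a k l; rewrite (ord1 k) (ord1 l) eqxx.
  move=> a; rewrite coboundary_family0E !ffunE.
  have in_sum k l : a k = ord0 -> a l != ord0 ->
      x \in bigsum_sub (fun k => I (a k)).
    move=> ak /xI; apply: mem_sum_sub_min => y yI.
      by apply: (mem_bigsum_sub (k := k)); rewrite ak.
    exact: (mem_bigsum_sub (k := l)).
  case: eqP => [a1|/eqP a1]; case: eqP => [a0|/eqP a0];
    rewrite ?subrr ?rpred0 //.
    by rewrite sub0r rpredN; apply: in_sum a1 a0.
  by rewrite subr0; apply: in_sum a0 a1.
pose w : cochain_complex I 1 := Sub (coboundary_family g) wI.
have wc : w \in @cocycle_pred (cochain_complex I) 1.
  by rewrite inE; apply/eqP; apply: val_inj; apply: coboundary_coboundary.
pose wz : cocycles (cochain_complex I) 1 := Sub w wc.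
have /cohomology_map_bijP[_ /(_ wz)[z [h]]] := qI 2 I LI 1.
rewrite /= subr0 => /(congr1 val) /= wh.
pose y k := val h [ffun=> k].
have yI k : y k \in I k.
  have /cochainE[_ /(_ [ffun=> k])] := valP h.
  by rewrite bigsum_sub1 ffunE.
have yE k l :
    y k - y l = (if k == ord0 then 0 else x) - (if l == ord0 then 0 else x).
  have := congr1 (fun f : family_of A 2 1 => f (cons_index l [ffun=> k])) wh.
  rewrite /= !coboundary_family0E !cons_index_lift !cons_index0 !ffunE => ->.
  by rewrite /y.
pose k1 : 'I_3 := Ordinal (isT : (1 < 3)%N).
pose k2 : 'I_3 := Ordinal (isT : (2 < 3)%N).
have y12 : y k1 = y k2 by apply/eqP; rewrite -subr_eq0 yE subrr.
apply/sum_subP; exists (- y ord0), (y k1); split.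
- by rewrite rpredN; apply: yI.
- by apply/andP; split; [apply: (yI k1) | rewrite y12; apply: (yI k2)].
- by rewrite addrC yE /= subr0.
Qed.

End Equivalence.

Theorem corollary3 (A : zmodType) (L : set (zmodClosed A))
    (hL : lattice_of_subgroups L) :
  distributive L <->
  (forall (n : nat) (I : 'I_n.+1 -> zmodClosed A),
     (forall k, L (I k)) -> quasi_isomorphism (canonical_morphism I)).
Proof.
split=> [dL n I LI|]; first exact: (distributive_quasi_isomorphism hL).
exact: quasi_isomorphism_distributive.
Qed.
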